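(* Let $P$ be any finite poset. Then, as $n\to\infty$, $$\operatorname{La}^{\#*}(n,P)\sim\frac{|P|}{c^*(P)}\binom{n}{\lfloor n/2\rfloor},$$ where $\operatorname{La}^{\#*}(n,P)$ and $c^*(P)$ are as defined in the context.
   Context: For $n\ge 0$, $\mathcal{B}_n$ denotes the Boolean lattice: the family of all subsets of $[n]=\{1,\dots,n\}$ ordered by inclusion. A strong embedding of a finite poset $P$ into $\mathcal{B}_n$ is an injective map $f:P\to\mathcal{B}_n$ such that for all $a,b\in P$, $a<b$ if and only if $f(a)\subsetneq f(b)$; its image $f(P)$ is called an induced copy of $P$ in $\mathcal{B}_n$. Induced copies $\mathcal{F}_1,\mathcal{F}_2,\dots$ of $P$ are pairwise unrelated if whenever $i\ne j$, $A\in\mathcal{F}_i$ and $A'\in\mathcal{F}_j$, the sets $A$ and $A'$ are incomparable under inclusion. $\operatorname{La}^{\#*}(n,P)$ denotes the maximum of $|\bigcup_i\mathcal{F}_i|$ over all families of pairwise unrelated induced copies $\mathcal{F}_i$ of $P$ in $\mathcal{B}_n$. For $\mathcal{F}\subseteq\mathcal{B}_k$, its convex closure is $\overline{\mathcal{F}}=\{S\in\mathcal{B}_k : A\subseteq S\subseteq B \text{ for some } A,B\in\mathcal{F}\}$. Finally, $c^*(P)$ is the minimum of $|\overline{f(P)}|$ over all $k\ge0$ and all strong embeddings $f$ of $P$ into $\mathcal{B}_k$. *)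

(* Defs.v *)
From HB Require Import structures.
From mathcomp Require Import all_boot all_order all_algebra.
From mathcomp Require Import all_classical all_reals all_analysis.
Set Implicit Arguments.
Unset Strict Implicit.
Unset Printing Implicit Defensive.
Import Order.TTheory.
Import numFieldNormedType.Exports.

(* B_n is {set 'I_n}: the ground set [n] is rendered as 'I_n = {0, ..., n-1}. *)

Definition convex_closure (k : nat) (F : {set {set 'I_k}}) : {set {set 'I_k}} :=
  [set S : {set 'I_k} |
    [exists A in F, exists B in F, (A \subset S) && (S \subset B)]].

Definition pairwise_unrelated (n : nat) (FF : {set {set {set 'I_n}}}) : bool :=
  [forall F1 in FF, forall F2 in FF, (F1 != F2) ==>
    [forall A in F1, forall B in F2, ~~ (A \subset B) && ~~ (B \subset A)]].

Section FinitePoset.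

Variables (d : Order.disp_t) (P : finPOrderType d).

Definition strong_embedding (n : nat) (f : {ffun P -> {set 'I_n}}) : bool :=
  injectiveb f && [forall a, forall b, (a < b)%O == (f a \proper f b)].

Definition image_family (n : nat) (f : {ffun P -> {set 'I_n}}) :
  {set {set 'I_n}} := [set f a | a : P].

Definition induced_copy (n : nat) (F : {set {set 'I_n}}) : bool :=
  [exists f : {ffun P -> {set 'I_n}},
    strong_embedding f && (F == image_family f)].

(* Unrelated copies with distinct indices are automatically distinct (a set is
   comparable to itself) unless they are empty, so a family of copies is a set
   of copies.  The max is over a nonempty range: FF = set0 qualifies. *)
Definition La_sharp_star (n : nat) : nat :=
  \max_(FF : {set {set {set 'I_n}}} |
      [forall F in FF, induced_copy F] && pairwise_unrelated FF) #|finset.cover FF|.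

Definition closure_size (m : nat) : Prop :=
  exists (k : nat) (f : {ffun P -> {set 'I_k}}),
    strong_embedding f /\ #|convex_closure (image_family f)| = m.

(* Every finite poset embeds as its principal down-sets, so the minimum below
   ranges over a nonempty set of sizes. *)
Lemma closure_size_exists : exists m : nat, `[< closure_size m >].
Proof.
pose f : {ffun P -> {set 'I_#|P|}} :=
  [ffun a => [set i | (enum_val i <= a)%O]].
suff fE : strong_embedding f.
  by eexists; apply/asboolP; exists #|P|, f; split; [exact: fE|].
have fS a b : (f a \subset f b) = (a <= b)%O.
  apply/fintype.subsetP/idP => [/(_ (enum_rank a)) | ab i].
    by rewrite !ffunE !inE enum_rankK; apply.
  by rewrite !ffunE !inE => /le_trans; apply.
apply/andP; split; last first.
  apply/forallP => a; apply/forallP => b; apply/eqP.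
  by rewrite properE !fS lt_leAnge.
apply/injectiveP => a b fab; apply/le_anti.
by rewrite -!fS fab subxx.
Qed.

Definition cstar : nat := ex_minn closure_size_exists.

End FinitePoset.

(* u = v + o(v): this is u n / v n --> 1 when v has no zero, and it still makes
   sense for the empty poset, where both sequences vanish. *)
Definition asymp_equiv (R : realType) (u v : nat -> R) : Prop :=
  ((u : nat -> R^o) ~_\oo (v : nat -> R^o))%classic.

(* Main.v *)
(* Upper bound: in a family of unrelated copies the convex closures are
   unrelated too, and each has at least c*(P) members.  Choose c*(P) of them in
   each closure; a random maximal chain meets at most one of the closures, and
   given that it contains a chosen set, with probability 1 - o(1) no larger
   chosen one, so an LYM-type inequality bounds the number of copies by
   (1 + o(1)) C(n, n/2) / c*(P).  Copies containing a set of bounded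
   codimension are negligible in number.

   Lower bound: let f embed P into B_k with a closure C of size c*(P).  Since C
   is convex, collapsing it to a point leaves an acyclic relation on B_k.
   Iterating over products of t copies of B_k gives disjoint copies of P in
   B_{kt} whose closures cover a proportion 1 - (1 - c*(P) / 2^k)^t of it, the
   order relation between distinct copies being acyclic.  Multiplying a copy of
   height h by the sets of size n/2 - h of the remaining n - kt points makes
   the copies unrelated, and C(n - kt, n/2 - h) ~ C(n, n/2) / 2^{kt}. *)

Require Import Defs.
From HB Require Import structures.
From mathcomp Require Import all_classical all_reals all_analysis.
From mathcomp Require Import all_boot all_order all_algebra.
From mathcomp Require Import perm zify ring lra.
Set Implicit Arguments.
Unset Strict Implicit.
Unset Printing Implicit Defensive.
Import Order.TTheory GRing.Theory Num.Theory.
Local Open Scope nat_scope.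

(** * Binomial and set preliminaries *)

Lemma leq_bin_half n k : 'C(n, k) <= 'C(n, n./2).
Proof.
have step j : j.*2 < n -> 'C(n, j) <= 'C(n, j.+1).
  move=> jn; rewrite -(leq_pmul2l (ltn0Sn j)) mul_bin_left leq_mul2r.
  by rewrite ltn_subRL addnn jn orbT.
have half d : 'C(n, n./2 - d) <= 'C(n, n./2).
  elim: d => [|d]; rewrite ?subn0 //; apply: leq_trans.
  case: (leqP n./2 d) => nd.
    have/eqP -> : n./2 - d == 0 by rewrite subn_eq0.
    by have/eqP -> : n./2 - d.+1 == 0 by rewrite subn_eq0 leqW.
  rewrite -[n./2 - d]prednK ?subn_gt0 // -subnS step //.
  have := odd_double_half n; move: (n./2) nd => h nd; lia.
case: (leqP k n./2) => [kn|nk]; first by rewrite -(subKn kn) half.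
case: (leqP k n) => kn; last by rewrite bin_small.
have nk2 : n - k <= n./2 by move: (odd_double_half n) nk; move: (n./2) => h; lia.
by rewrite -bin_sub // -(subKn nk2) half.
Qed.

Lemma setUDsub (T : finType) (A B : {set T}) : A \subset B -> A :|: B :\: A = B.
Proof. by move=> AB; rewrite setDE setUIr setUCr setIT; apply/setUidPr. Qed.

(** * Maximal chains and an LYM-type inequality *)

Section Chains.
Variable n : nat.
Implicit Types (s : {perm 'I_n}) (A B D : {set 'I_n}) (G : {set {set 'I_n}}).

(** A permutation [s] encodes the maximal chain that adds each element [x] at time [s x]. *)
Definition prefix s k : {set 'I_n} := [set x | s x < k].

Definition in_chain s A := A == prefix s #|A|.

Lemma card_prefix s k : k <= n -> #|prefix s k| = k.
Proof.
move=> kn; transitivity #|[set i : 'I_n | i < k]|.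
  rewrite -(card_preimset [set i : 'I_n | i < k] (@perm_inj _ s)).
  by apply: eq_card => x; rewrite !inE.
suff -> : [set i : 'I_n | i < k] = widen_ord kn @: [set: 'I_k].
  by rewrite card_imset ?cardsT ?card_ord // => i j /(congr1 val) /= /val_inj.
apply/setP => i; rewrite inE; apply/idP/imsetP => [ik | [j _ ->]].
  by exists (Ordinal ik) => //; apply: val_inj.
by rewrite /= ltn_ord.
Qed.

Lemma in_chain_prefix s k : k <= n -> in_chain s (prefix s k).
Proof. by move=> kn; rewrite /in_chain card_prefix. Qed.

Lemma prefixS s k l : k <= l -> prefix s k \subset prefix s l.
Proof. by move=> kl; apply/subsetP => x; rewrite !inE => /leq_trans; apply. Qed.

Lemma in_chain_comparable s A B :
  in_chain s A -> in_chain s B -> (A \subset B) || (B \subset A).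
Proof.
by move=> /eqP -> /eqP ->; case/orP: (leq_total #|A| #|B|) => /(prefixS s) ->;
  rewrite ?orbT.
Qed.

Lemma in_chain_tperm s A x y :
  in_chain (tperm x y * s)%g A = in_chain s (tperm x y @: A).
Proof.
rewrite /in_chain card_imset; last exact: perm_inj.
have -> : prefix (tperm x y * s)%g #|A| = tperm x y @^-1: prefix s #|A|.
  by apply/setP => z; rewrite !inE permM.
rewrite -(inj_eq (imset_inj (@perm_inj _ (tperm x y)))).
suff -> : forall B, tperm x y @: (tperm x y @^-1: B) = B by [].
move=> B; apply/setP => z; rewrite -{1}(tpermK x y z) mem_imset ?inE ?tpermK //.
exact: perm_inj.
Qed.

Definition chain_count A B := #|[set s | in_chain s A & in_chain s B]|.

(** Take [x] in [D :\: D'] and [y] in [D' :\: D]. Composing with their transposition permutes the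
    chains, fixes [A], and moves [D] one element closer to [D']. *)
Lemma chain_count_exchange A D D' :
  [disjoint A & D] -> [disjoint A & D'] -> #|D| = #|D'| ->
  chain_count A (A :|: D) = chain_count A (A :|: D').
Proof.
move: {2}#|_| (erefl #|D :\: D'|) => m.
elim: m => [|m IHm] in D *.
  move=> /eqP; rewrite cards_eq0 setD_eq0 => DD' _ _ cD.
  by suff -> : D = D' by []; apply/eqP; rewrite eqEcard DD' cD /=.
move=> cDD' dAD dAD' cD.
have [x xDD'] : exists x, x \in D :\: D' by apply/card_gt0P; rewrite cDD'.
have [y yDD'] : exists y, y \in D' :\: D.
  apply/card_gt0P; rewrite cardsD setIC -cD; move: cDD'; rewrite cardsD.
  by move=> ->.
move: xDD' yDD'; rewrite !inE => /andP[xD' xD] /andP[yD yD'].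
have xA : x \notin A by apply: contraL xD => /(disjointFr dAD) ->.
have yA : y \notin A by apply: contraL yD' => /(disjointFr dAD') ->.
have tA : tperm x y @: A = A.
  rewrite -[RHS]imset_id; apply: eq_in_imset => z zA; rewrite tpermD //.
    by apply: contraNneq xA => ->.
  by apply: contraNneq yA => ->.
have tD z : (z \in tperm x y @: D) = (tperm x y z \in D).
  by rewrite -{1}(tpermK x y z) mem_imset //; exact: perm_inj.
rewrite -(IHm (tperm x y @: D)) //.
- rewrite /chain_count -[LHS](card_preimset _ (mulgI (tperm x y))).
  by apply: eq_card => s; rewrite !inE !in_chain_tperm imsetU tA.
- have -> : tperm x y @: D :\: D' = (D :\: D') :\ x.
    apply/setP => z; rewrite !inE tD; case: tpermP => [->|->|/eqP zx /eqP zy].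
    + by rewrite (negPf yD) eqxx /= andbF.
    + by rewrite yD' /= andbF.
    + by rewrite zx.
  by move: (cardsD1 x (D :\: D')); rewrite cDD' !inE xD xD' => -[].
- by rewrite -tA; rewrite imset_disjoint //; exact: perm_inj.
- by rewrite card_imset //; exact: perm_inj.
Qed.

(** Double counting: each chain through [A] contains exactly one set of size [#|A| + #|D|], and by
    exchange every candidate superset of [A] of that size receives equally many chains. *)
Lemma chain_countM A D : [disjoint A & D] ->
  chain_count A (A :|: D) * 'C(n - #|A|, #|D|) = #|[set s | in_chain s A]|.
Proof.
move=> dAD.
have cA : #|~: A| = n - #|A| by rewrite cardsCs setCK card_ord.
rewrite -cA -cards_draws mulnC -sum_nat_const.
rewrite (eq_bigr (fun D' : {set 'I_n} => chain_count A (A :|: D'))); last first.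
  move=> D' /[!inE] /andP[sD' /eqP cD'].
  by apply: chain_count_exchange => //; rewrite disjoints_subset subsetC.
under eq_bigr => D' _ do rewrite /chain_count -sum1dep_card.
rewrite -[RHS]sum1dep_card.
rewrite (exchange_big_dep (in_chain^~ A)) /=; last by move=> D' s _ /andP[].
apply: eq_bigr => s sA.
rewrite sum1dep_card.
have cAD : #|A :|: D| = #|A| + #|D|.
  by rewrite cardsU (disjoint_setI0 dAD) cards0 subn0.
have lADn : #|A| + #|D| <= n by rewrite -cAD -[leqRHS]card_ord max_card.
pose B := prefix s (#|A| + #|D|).
have AB : A \subset B.
  by rewrite (eqP sA); apply: prefixS; rewrite leq_addr.
rewrite -[RHS](cards1 (B :\: A)); apply: eq_card => D'.
rewrite !inE; apply/idP/eqP => [/andP[/andP[sD' /eqP cD'] /andP[_ /eqP sAD']]|->].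
  have dAD' : [disjoint A & D'] by rewrite disjoints_subset subsetC.
  rewrite /B -cD' -[_ + _](_ : #|A :|: D'| = _).
    rewrite -sAD' setDUl setDv set0U; apply/esym/setDidPl.
    by rewrite disjoint_sym.
  by rewrite cardsU (disjoint_setI0 dAD') cards0 subn0.
rewrite setUDsub //.
rewrite sA in_chain_prefix // cardsDS // card_prefix // addKn eqxx !andbT.
by rewrite setDE subsetIr.
Qed.

Lemma card_in_chain A : #|[set s | in_chain s A]| * 'C(n, #|A|) = n`!.
Proof.
have e0 s : in_chain s set0.
  by apply/eqP/setP => x; rewrite !inE cards0 ltn0.
have d0 : [disjoint set0 & A] by rewrite disjoints_subset sub0set.
have := chain_countM d0; rewrite cards0 subn0.
rewrite set0U /chain_count.
under eq_finset do rewrite e0 /=.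
under [in RHS]eq_finset do rewrite e0.
by move=> ->; rewrite cardsT card_Sn.
Qed.

Lemma leq_bin_gap m k : 0 < k < m -> m <= 'C(m, k).
Proof.
elim: m k => [|m IHm] [|k] //=; rewrite ltnS => km.
have [<-|nkm] := eqVneq k.+1 m; first by rewrite binSn.
have km1 : k.+1 < m by rewrite ltn_neqAle nkm.
by rewrite binS -[m.+1]addn1 leq_add ?bin_gt0 ?IHm // ltnW.
Qed.

(** A random chain through [A] meets [B] with probability at most [1 / (n - #|A|)]. The full set
    must be excluded, since every chain contains it. *)
Lemma leq_chain_count A B : A \proper B -> B \proper setT ->
  chain_count A B * (n - #|A|) <= #|[set s | in_chain s A]|.
Proof.
move=> AB BT.
have dA : [disjoint A & B :\: A] by rewrite disjoint_sym disjoints_subset subsetDr.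
have eB : A :|: B :\: A = B by rewrite setUDsub ?proper_sub.
have := proper_card (proper_trans AB BT); have := proper_card BT.
rewrite cardsT card_ord => Bn An; rewrite -(chain_countM dA) eB.
rewrite leq_mul2l leq_bin_gap ?orbT // cardsDS ?proper_sub //.
by rewrite subn_gt0 proper_card // ltn_sub2r.
Qed.

(* Each chain is charged to the largest member of [G] on it, so that the
   chains through [A] lost to larger members are at most a [c / K]
   proportion. *)
Lemma lym_few_supersets G c K : 0 < K ->
  (forall A, A \in G -> #|A| + K <= n) ->
  (forall A, A \in G -> #|[set B in G | A \proper B]| <= c) ->
  #|G| * (K - c) <= K * 'C(n, n./2).
Proof.
move=> K0 GK Gc.
pose E A := [set s | in_chain s A & [forall (B | (B \in G) && (A \proper B)), ~~ in_chain s B]].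
have EG A : A \in G -> #|[set s | in_chain s A]| * (K - c) <= K * #|E A|.
  move=> AG.
  have : #|[set s | in_chain s A]| <=
         #|E A| + \sum_(B in G | A \proper B) chain_count A B.
    rewrite -sum1_card -[#|E A|]sum1_card.
    rewrite (bigID (mem (E A))) /= leq_add //.
      apply/eq_leq/eq_bigl => s; rewrite !inE.
      by case: (in_chain s A).
    rewrite (eq_bigr (fun B => \sum_(s | in_chain s A && in_chain s B) 1)); last first.
      by move=> B _; rewrite sum1dep_card.
    rewrite (exchange_big_dep (in_chain^~ A)) /=; last by move=> B s _ /andP[].
    rewrite big_mkcond [leqRHS]big_mkcond /= leq_sum // => s _.
    rewrite !inE; case: (boolP (in_chain s A)) => //= sA.
    case: forall_inP => //= /forall_inP; rewrite negb_forall_in => /exists_inP[B].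
    by rewrite negbK => BGA sB; rewrite (bigD1 B) ?BGA.
  rewrite -(leq_pmul2l K0) mulnDr => le1.
  rewrite mulnBr leq_subLR mulnC (leq_trans le1) // addnC leq_add2r.
  rewrite big_distrr /=.
  apply: (@leq_trans (\sum_(B in G | A \proper B) #|[set s | in_chain s A]|)).
    apply: leq_sum => B /andP[BG AB].
    apply: leq_trans (leq_chain_count AB _).
      by rewrite mulnC leq_mul2l leq_subRL ?GK ?orbT // -[leqRHS](card_ord n) max_card.
    rewrite properEcard subsetT cardsT card_ord /=.
    by apply: leq_trans (GK B BG); rewrite -addn1 leq_add2l.
  rewrite sum_nat_cond_const mulnC leq_mul2l.
  by rewrite Gc ?orbT.
(* The [E A] are disjoint: two members of [G] on one chain are comparable, and the larger excludes
   the chain from the set of the smaller. *)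
have trivE : \sum_(A in G) #|E A| <= n`!.
  rewrite -card_Sn -sum1_card.
  rewrite (eq_bigr (fun A => \sum_(s | s \in E A) 1)); last first.
    by move=> A _; rewrite sum1_card.
  rewrite (exchange_big_dep predT) //= leq_sum // => s _.
  rewrite sum1dep_card leqNgt; apply/negP => /card_gt1P[A [B [+ + AB]]].
  rewrite !inE => /and3P[AG sA /forall_inP EA] /and3P[BG sB /forall_inP EB].
  case/orP: (in_chain_comparable sA sB) => sAB.
    by move: (EA B); rewrite BG properEneq AB sAB sB => /(_ isT).
  by move: (EB A); rewrite AG properEneq eq_sym AB sAB sA => /(_ isT).
rewrite -(leq_pmul2l (fact_gt0 n)).
apply: (@leq_trans (K * 'C(n, n./2) * \sum_(A in G) #|E A|)); last first.
  by rewrite mulnC leq_mul2r trivE orbT.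
rewrite mulnCA -sum_nat_const big_distrr /= leq_sum // => A AG.
rewrite -(card_in_chain A) mulnAC.
apply: leq_trans (leq_mul (EG A AG) (leq_bin_half n #|A|)) _.
by rewrite mulnAC.
Qed.

End Chains.

(** * The upper bound at fixed [n] *)

Lemma card_sets_lt (T : finType) K :
  #|[set A : {set T} | #|A| < K]| <= \sum_(i < K) 'C(#|T|, i).
Proof.
rewrite (eq_bigr (fun i : 'I_K => \sum_(A : {set T} | #|A| == i) 1)); last first.
  by move=> i _; rewrite sum1dep_card card_draws.
rewrite (exchange_big_dep predT) //= -sum1dep_card big_mkcond leq_sum // => A _.
by case: ifP => // AK; rewrite (bigD1 (Ordinal AK)) /= ?eqxx.
Qed.

Section UpperBound.
Variables (d : Order.disp_t) (P : finPOrderType d) (n : nat).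

Lemma card_induced_copy (F : {set {set 'I_n}}) : induced_copy P F -> #|F| = #|P|.
Proof.
case/existsP => f /andP[/andP[/injectiveP f_inj _] /eqP ->].
by rewrite card_imset.
Qed.

Lemma cstar_le (F : {set {set 'I_n}}) :
  induced_copy P F -> cstar P <= #|convex_closure F|.
Proof.
case/existsP => f /andP[fE /eqP ->]; rewrite /cstar; case: ex_minnP => m _.
by apply; apply/boolp.asboolP; exists n, f.
Qed.

Lemma cstar_gt0 : 0 < #|P| -> 0 < cstar P.
Proof.
move=> P0; rewrite /cstar; case: ex_minnP => m /boolp.asboolP[k [f [fE <-]]] _.
have /card_gt0P[a _] := P0.
apply/card_gt0P; exists (f a); rewrite inE.
by apply/exists_inP; exists (f a); rewrite ?imset_f //; apply/exists_inP;
  exists (f a); rewrite ?imset_f ?subxx.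
Qed.

Variable FF : {set {set {set 'I_n}}}.
Hypothesis unrelFF : pairwise_unrelated FF.

(** Some member of [F1] lies below [A] and some member of [F2] above [B]. With [A = B] this also
    shows that closures of distinct copies are disjoint. *)
Lemma closure_unrelated (F1 F2 : {set {set 'I_n}}) A B : F1 \in FF -> F2 \in FF ->
  A \in convex_closure F1 -> B \in convex_closure F2 -> A \subset B -> F1 = F2.
Proof.
move=> F1F F2F; rewrite !inE => /exists_inP[A1 A1F /exists_inP[_ _ /andP[A1A _]]].
move=> /exists_inP[_ _ /exists_inP[B2 B2F /andP[_ BB2]]] AB.
apply/eqP/contraT => F12.
move: unrelFF => /forall_inP /(_ _ F1F) /forall_inP /(_ _ F2F).
rewrite F12 /= => /forall_inP /(_ _ A1F) /forall_inP /(_ _ B2F) /andP[/negP[]].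
exact: subset_trans A1A (subset_trans AB BB2).
Qed.

Lemma sub_closure (F : {set {set 'I_n}}) : F \subset convex_closure F.
Proof.
apply/subsetP => A AF; rewrite inE; apply/exists_inP; exists A => //.
by apply/exists_inP; exists A; rewrite ?subxx.
Qed.

(** Picking one large set in each such copy is injective because the copies are unrelated, and the
    complements of the picked sets have fewer than [K] elements. *)
Lemma bad_copies K :
  #|[set F in FF | [exists A in F, n < #|A| + K]]| <= \sum_(i < K) 'C(n, i).
Proof.
set bad := [set F in FF | _].
have [w wP] : exists w : {set {set 'I_n}} -> {set 'I_n},
    forall F, F \in bad -> w F \in F /\ n < #|w F| + K.
  exists (fun F : {set {set 'I_n}} =>
            odflt set0 [pick A : {set 'I_n} | (A \in F) && (n < #|A| + K)]).
  move=> F; rewrite inE => /andP[_ /exists_inP[A AF nA]].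
  by case: pickP => [B /andP[]|/(_ A)] //=; rewrite AF nA.
have w_inj : {in bad &, injective w}.
  move=> F1 F2 b1 b2 e12; have [w1 _] := wP _ b1; have [w2 _] := wP _ b2.
  move: b1 b2; rewrite !inE => /andP[F1F _] /andP[F2F _].
  by apply: (closure_unrelated F1F F2F (subsetP (sub_closure F1) _ w1)
               (subsetP (sub_closure F2) _ w2)); rewrite e12.
rewrite -(card_in_imset w_inj) -(card_imset _ (@setC_inj _)).
apply: leq_trans (subset_leq_card _) (leq_trans (card_sets_lt _ K) _).
  apply/subsetP => _ /imsetP[_ /imsetP[F /wP[_ nF] ->] ->].
  rewrite inE cardsCs setCK card_ord.
  by have : #|w F| <= n; [rewrite -[leqRHS]card_ord max_card | lia].
by rewrite card_ord.
Qed.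

Hypothesis copyFF : [forall F in FF, induced_copy P F].

Lemma card_cover_copies : #|finset.cover FF| <= #|FF| * #|P|.
Proof.
rewrite (leq_trans (leq_card_cover FF)) // -sum_nat_const leq_sum // => F FFF.
by rewrite card_induced_copy // (forall_inP copyFF).
Qed.

(** The LYM-type bound is applied to a union of [cstar P] chosen sets from each closure. Chosen sets
    above a given one come from the same closure, so there are at most [cstar P] of them; their
    codimension is at least [K] since each lies below a member of its copy. *)
Lemma good_copies K : 0 < K ->
  #|[set F in FF | ~~ [exists A in F, n < #|A| + K]]| * (cstar P * (K - cstar P))
    <= K * 'C(n, n./2).
Proof.
move=> K0; set good := [set F in FF | _]; set c := cstar P.
have [G GP] : exists G : {set {set 'I_n}} -> {set {set 'I_n}}, forall F,
    (F \in good -> (G F \subset convex_closure F) /\ #|G F| = c) /\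
    (F \notin good -> G F = set0).
  exists (fun F => if F \in good then
    odflt set0 [pick H : {set {set 'I_n}} | (H \subset convex_closure F) && (#|H| == c)]
    else set0) => F; split=> [Fg|/negPf -> //]; rewrite Fg.
  case: pickP => [H /andP[HF /eqP Hc] //|] none.
  have : 0 < #|[set H : {set {set 'I_n}} | H \subset convex_closure F & #|H| == c]|.
    rewrite cards_draws bin_gt0 cstar_le //.
    by move: Fg; rewrite inE => /andP[FF_F _]; rewrite (forall_inP copyFF).
  by case/card_gt0P => H; rewrite inE none.
have goodFF F : F \in good -> F \in FF by rewrite inE => /andP[].
have GFF F A : A \in G F -> [/\ F \in good, F \in FF & A \in convex_closure F].
  case: (boolP (F \in good)) => [Fg|/(GP F).2 ->]; last by rewrite inE.
  by move=> /(subsetP ((GP F).1 Fg).1) ?; split=> //; apply: goodFF.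
have G_unrel F1 F2 A B : A \in G F1 -> B \in G F2 -> A \subset B -> F1 = F2.
  by move=> /GFF[_ F1F A1] /GFF[_ F2F B2]; apply: closure_unrelated A1 B2.
have cardG : #|\bigcup_F G F| = #|good| * c.
  rewrite -sum1_card partition_disjoint_bigcup /=; last first.
    move=> F1 F2; apply: contraNT => /pred0Pn[A /andP[A1 A2]].
    by apply/eqP/(G_unrel _ _ _ _ A1 A2).
  rewrite (bigID (mem good)) /= [X in _ + X]big1 => [|F Fg].
    rewrite addn0 -sum_nat_const; apply: eq_bigr => F Fg.
    by rewrite sum1_card ((GP F).1 Fg).2.
  by rewrite sum1_card (GP F).2 ?cards0.
rewrite mulnA -cardG; apply: lym_few_supersets => // A /bigcupP[F _ AF].
  have [] := GFF _ _ AF; rewrite inE => /andP[_ /exists_inPn Fgood] _.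
  rewrite inE => /exists_inP[_ _ /exists_inP[B BF /andP[_ AB]]].
  have := Fgood _ BF; rewrite -leqNgt; apply: leq_trans.
  by rewrite leq_add2r subset_leq_card.
have [Fg _ _] := GFF _ _ AF; rewrite -((GP F).1 Fg).2.
apply/subset_leq_card/subsetP => B; rewrite inE => /andP[/bigcupP[F' _ BF'] AB].
by rewrite (G_unrel _ _ _ _ AF BF' (proper_sub AB)).
Qed.

End UpperBound.

Lemma La_upper (d : Order.disp_t) (P : finPOrderType d) n K : 0 < K ->
  La_sharp_star P n * (cstar P * (K - cstar P)) <=
  #|P| * (K * 'C(n, n./2) + cstar P * (K - cstar P) * \sum_(i < K) 'C(n, i)).
Proof.
move=> K0; rewrite /La_sharp_star.
apply: (big_ind (fun m => m * _ <= _)) => //.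
  by move=> x y xle yle; rewrite maxnMl geq_max xle yle.
move=> FF /andP[copyFF unrelFF].
apply: leq_trans (leq_mul (card_cover_copies copyFF) (leqnn _)) _.
rewrite mulnAC mulnC leq_mul2l; apply/orP; right.
rewrite -(cardsID [set F in FF | [exists A in F, n < #|A| + K]] FF) mulnDl addnC.
apply: leq_add.
  apply: leq_trans (good_copies unrelFF copyFF K0).
  rewrite leq_mul2r; apply/orP; right; apply/subset_leq_card/subsetP => F.
  by rewrite !inE; case: (F \in FF); rewrite ?andbT.
rewrite mulnC leq_mul2l; apply/orP; right.
apply: leq_trans (bad_copies unrelFF K).
by apply/subset_leq_card/subsetIr.
Qed.

(** * Acyclic packings of copies in product lattices *)

Lemma card_set_type (T : finType) : #|{set T}| = 2 ^ #|T|.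
Proof. by rewrite -[#|T|]cardsT -card_powerset powersetT cardsT. Qed.

Section Packing.
Variables (d : Order.disp_t) (P : finPOrderType d).

(* The relation "some member of copy [i] lies below some member of copy [j]"
   is acyclic on distinct indices, as witnessed by the height [h]. *)
Definition acyclic_packing (T I : finType) (e : I -> P -> {set T}) (h : I -> nat) :=
  (forall i a b, (e i a \subset e i b) = (a <= b)%O) /\
  (forall i j a b, i != j -> e i a \subset e j b -> h i < h j).

(** This identifies the product of two Boolean lattices with the Boolean lattice on the disjoint
    union. *)
Definition set_sum (T1 T2 : finType) (A : {set T1}) (B : {set T2}) : {set T1 + T2} :=
  [set x | match x with inl y => y \in A | inr z => z \in B end].

Lemma set_sumS (T1 T2 : finType) (A A' : {set T1}) (B B' : {set T2}) :
  (set_sum A B \subset set_sum A' B') = (A \subset A') && (B \subset B').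
Proof.
apply/subsetP/andP => [sAB|[/subsetP sA /subsetP sB] [y|z]]; rewrite ?inE.
- by split; apply/subsetP => x xA;
    [have := sAB (inl x) | have := sAB (inr x)]; rewrite !inE; apply.
- exact: sA.
- exact: sB.
Qed.

(* One step of the packing lives in the product of the Boolean lattices on [U]
   and [T]: a new copy is placed on each fibre [C x {S}], and the packing of
   the lattice on [T] is repeated over each [X] outside [C]. *)
Section Step.
Variables (U : finType) (f : P -> {set U}).
Hypothesis fE : forall a b, (f a \subset f b) = (a <= b)%O.
Let C := [set S : {set U} | [exists a, exists b, (f a \subset S) && (S \subset f b)]].

(* A linear extension of the Boolean lattice on [U] with [C] collapsed. *)
Let g (X : {set U}) : nat :=
  if X \in C then #|U|.+1
  else if [exists b, X \subset f b] then #|X| else #|U|.+2 + #|X|.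

(** Sets outside [C] below some [f b] get values at most [#|U|], the remaining ones values above
    [#|U|.+1]. A set outside [C] that contains a member of [C] is below no [f b], by convexity. *)
Let gS (X Y : {set U}) : X \subset Y -> [\/ X \in C /\ Y \in C, X = Y | g X < g Y].
Proof.
move=> XY; have [->|nXY] := eqVneq X Y; first by constructor 2.
have cXY : #|X| < #|Y| by rewrite proper_card // properEneq nXY.
have cYU : #|Y| <= #|U| by rewrite max_card.
rewrite /g; case: (boolP (X \in C)) => XC; case: (boolP (Y \in C)) => YC.
- by constructor 1.
- have YX b : Y \subset f b -> False.
    move=> Yb; move: XC; rewrite inE => /existsP[a /existsP[_ /andP[aX _]]].
    by move: YC; rewrite inE => /existsPn/(_ a)/existsPn/(_ b); rewrite Yb (subset_trans aX XY).
  by case: existsP => [[b /YX] //|_]; constructor 3; lia.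
- case: existsP => [[b Xb]|nX]; first by constructor 3; lia.
  case: nX; move: YC; rewrite inE => /existsP[_ /existsP[b /andP[_ Yb]]].
  by exists b; apply: subset_trans Yb.
- constructor 3; case: existsP => [[b Xb]|nX].
    by case: existsP => _; lia.
  case: existsP => [[b Yb]|_]; last by lia.
  by case: nX; exists b; apply: subset_trans Yb.
Qed.

Variables (T I : finType) (e : I -> P -> {set T}) (h : I -> nat).
Hypothesis pack : acyclic_packing e h.

Definition step_index : finType := ({set T} + {X : {set U} | X \notin C} * I)%type.

Definition step_sets (i : step_index) (a : P) : {set U + T} :=
  match i with
  | inl Y => set_sum (f a) Y
  | inr (X, j) => set_sum (val X) (e j a)
  end.

(** [M] exceeds every [#|Y|] and every [h i], so that [step_height] compares lexicographically, the
    value of [g] coming first. *)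
Let M := (#|T| + \max_i h i).+1.

Definition step_height (i : step_index) : nat :=
  match i with
  | inl Y => M * #|U|.+1 + #|Y|
  | inr (X, j) => M * g (val X) + h j
  end.

Lemma card_step_index : #|step_index| = 2 ^ #|T| + (2 ^ #|U| - #|C|) * #|I|.
Proof.
rewrite card_sum card_prod card_sig card_set_type; congr (_ + _ * _).
by rewrite -card_set_type -(cardC [in C]) addKn.
Qed.

(** By [gS], comparable copies either increase [g] or share its value. In the latter case both are
    fibres over [C], ordered by [#|Y|], or both lie over the same [X], ordered by [h]. *)
Lemma acyclic_packing_step : acyclic_packing step_sets step_height.
Proof.
have [eE eh] := pack.
have fC a : f a \in C.
  by rewrite inE; apply/existsP; exists a; apply/existsP; exists a; rewrite subxx.
have gC X : X \in C -> g X = #|U|.+1 by rewrite /g => ->.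
have hM i : h i < M by rewrite ltnS (leq_trans _ (leq_addl _ _)) // leq_bigmax.
have sM (Y : {set T}) : #|Y| < M by rewrite ltnS (leq_trans _ (leq_addr _ _)) // max_card.
have lex x y u v : x < y -> u < M -> M * x + u < M * y + v.
  move=> xy uM; apply: (@leq_trans (M * x.+1)); first by rewrite mulnS addnC ltn_add2r.
  by rewrite (leq_trans _ (leq_addr _ _)) // leq_mul2l xy orbT.
split=> [[Y|[x i]] a b|[Y|[x i]] [Y'|[x' j]] a b] /=;
  rewrite set_sumS ?subxx ?andbT ?fE ?eE //.
- move=> nY /andP[_ YY]; rewrite ltn_add2l proper_card // properEneq YY andbT.
  by apply: contraNneq nY => ->.
- move=> _ /andP[/gS[[_ xC]|fx|gx] _]; first by have := valP x'; rewrite xC.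
    by have := valP x'; rewrite /= -fx fC.
  by apply: lex => //; rewrite -(gC (f a)).
- move=> _ /andP[/gS[[xC _]|fx|gx] _]; first by have := valP x; rewrite xC.
    by have := valP x; rewrite /= fx fC.
  by apply: lex => //; rewrite -(gC (f b)).
- move=> nij /andP[/gS[[xC _]|/val_inj xx'|gx] eij].
  + by have := valP x; rewrite xC.
  + subst x'; rewrite ltn_add2l; apply: eh eij.
    by apply: contraNneq nij => ->.
  + exact: lex.
Qed.

End Step.
End Packing.

(** * From packings to families of unrelated copies *)

Section Lower.
Variables (d : Order.disp_t) (P : finPOrderType d).

Lemma subset_embedding (T : finType) n : #|T| = n ->
  exists phi : {set T} -> {set 'I_n}, forall A B, (phi A \subset phi B) = (A \subset B).
Proof.
move=> <-; exists (fun A : {set T} => [set enum_rank x | x in A]) => A B.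
apply/idP/idP => [/subsetP sAB|/imsetS //]; apply/subsetP => x xA.
by have := sAB (enum_rank x); rewrite !mem_imset ?xA; try exact: enum_rank_inj; apply.
Qed.

Lemma La_lower_family n (J : finType) (e : J -> P -> {set 'I_n}) :
  (forall i a b, (e i a \subset e i b) = (a <= b)%O) ->
  (forall i j a b, e i a \subset e j b -> i = j) ->
  #|J| * #|P| <= La_sharp_star P n.
Proof.
move=> eE eU.
pose F i := [set e i a | a : P].
have FP i A : A \in F i -> exists a, A = e i a by case/imsetP => a _ ->; exists a.
pose FF := [set F i | i : J].
apply: leq_trans (leq_bigmax_cond _ _) => [|/=]; last first.
  apply/andP; split.
    apply/forall_inP => _ /imsetP[i _ ->]; apply/existsP.
    exists [ffun a => e i a]; apply/andP; split; last first.
      by apply/eqP; apply: eq_imset => a; rewrite ffunE.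
    apply/andP; split.
      apply/injectiveP => a b; rewrite !ffunE => eab.
      by apply/le_anti; rewrite -!(eE i) eab subxx.
    apply/forallP => a; apply/forallP => b; rewrite !ffunE.
    by rewrite properE !eE lt_leAnge.
  apply/forall_inP => _ /imsetP[i _ ->]; apply/forall_inP => _ /imsetP[j _ ->].
  apply/implyP => nij; apply/forall_inP => _ /FP[a ->].
  apply/forall_inP => _ /FP[b ->]; apply/andP; split; apply: contraNN nij.
    by move=> /eU ->.
  by move=> /eU ->.
have e_inj : injective (fun p : J * P => e p.1 p.2).
  move=> [i a] [j b] /= eab; have ij : i = j by apply: (eU _ _ a b); rewrite eab subxx.
  by subst j; congr (_, _); apply/le_anti; rewrite -!(eE i) eab subxx.
rewrite -card_prod -(card_imset _ e_inj).
apply/subset_leq_card/subsetP => _ /imsetP[[i a] _ ->].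
by apply/bigcupP; exists (F i); apply/imsetP; [exists i | exists a].
Qed.

(** A comparability between copies with distinct indices raises [h], hence lowers the size of the
    second component, which contradicts inclusion there. The bound on [h] keeps the subtraction from
    truncating. *)
Lemma La_lower (T I : finType) (e : I -> P -> {set T}) (h : I -> nat) n :
  acyclic_packing e h -> #|T| <= n -> (forall i, h i <= n./2) ->
  (\sum_i 'C(n - #|T|, n./2 - h i)) * #|P| <= La_sharp_star P n.
Proof.
move=> [eE eh] Tn hn; pose V := 'I_(n - #|T|).
have [phi phiS] : exists phi : {set T + V} -> {set 'I_n},
    forall A B, (phi A \subset phi B) = (A \subset B).
  by apply: subset_embedding; rewrite card_sum card_ord subnKC.
pose J := {p : I * {set V} | #|p.2| == n./2 - h p.1}.
have <- : #|{: J}| = \sum_i 'C(n - #|T|, n./2 - h i).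
  rewrite card_sig -sum1_card.
  rewrite (eq_bigl (fun p : I * {set V} => #|p.2| == n./2 - h p.1)) //.
  rewrite -(pair_big_dep predT (fun i (S : {set V}) => #|S| == n./2 - h i) (fun _ _ => 1)) /=.
  by apply: eq_bigr => i _; rewrite sum1dep_card card_draws card_ord.
apply: (@La_lower_family _ _ (fun p a => phi (set_sum (e (val p).1 a) (val p).2))).
  by move=> p a b; rewrite phiS set_sumS eE subxx andbT.
move=> [[i S] /= cS] [[j S'] /= cS'] a b /=; rewrite phiS set_sumS => /andP[eij SS'].
have cSS' := subset_leq_card SS'.
have [ij|/eh /(_ eij)] := eqVneq i j; last first.
  by move: cSS' (hn j); rewrite (eqP cS) (eqP cS'); lia.
apply: val_inj => /=; congr (_, _) => //.
by apply/eqP; rewrite eqEcard SS' (eqP cS) (eqP cS') ij /=.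
Qed.

Section Density.
Variables (k : nat) (f : {ffun P -> {set 'I_k}}).
Hypothesis fE : strong_embedding f.
Let c := #|convex_closure (image_family f)|.

Lemma strong_embedding_subset a b : (f a \subset f b) = (a <= b)%O.
Proof.
case/andP: fE => /injectiveP f_inj /forallP /(_ a) /forallP /(_ b) /eqP fab.
by rewrite subEproper -fab le_eqVlt (inj_eq f_inj).
Qed.

Lemma closure_image : convex_closure (image_family f) =
  [set S : {set 'I_k} | [exists a, exists b, (f a \subset S) && (S \subset f b)]].
Proof.
apply/setP => S; rewrite !inE; apply/exists_inP/existsP.
  case=> _ /imsetP[a _ ->] /exists_inP[_ /imsetP[b _ ->] SP].
  by exists a; apply/existsP; exists b.
case=> a /existsP[b SP]; exists (f a); first by rewrite imset_f.
by apply/exists_inP; exists (f b); rewrite ?imset_f.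
Qed.

(* After [t] steps the sets left uncovered by the closures of the copies are
   the words of length [t] over the complement of the closure of [f]. *)
Lemma dense_packing (t : nat) :
  exists (T I : finType) (e : I -> P -> {set T}) (h : I -> nat),
    [/\ acyclic_packing e h, #|T| = k * t &
    2 ^ (k * t) <= c * #|I| + (2 ^ k - c) ^ t].
Proof.
have c2 : c <= 2 ^ k.
  by rewrite -[in leqRHS](card_ord k) -card_set_type max_card.
elim: t => [|t [T [I [e [h [pack cT cI]]]]]].
  exists void, void, (fun _ _ => set0), (fun=> 0); split=> //.
    by rewrite muln0 card_void.
  by rewrite muln0 expn0 leq_addl.
exists ('I_k + T)%type, (step_index f T I), (@step_sets _ P _ f T I e), (@step_height _ P _ f T I h).
split; first by apply: acyclic_packing_step pack; exact: strong_embedding_subset.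
  by rewrite card_sum card_ord cT mulnS.
rewrite card_step_index -closure_image -/c card_ord cT mulnS expnD.
rewrite mulnDr -addnA mulnCA expnS -mulnDr.
(* Split [2 ^ k] as [c + (2 ^ k - c)]: fibres over the closure are fully covered, and the induction
   hypothesis is used over the other points. *)
rewrite -{1}(subnKC c2) mulnDl leq_add2l leq_mul2l cI orbT //.
Qed.

End Density.
End Lower.

(** * Asymptotic estimates *)

(** Already the ratio of ['C(n, i.+1)] to ['C(n, i)], which is [(n - i) / i.+1], is at least [M]. *)
Lemma fixed_bin_negligible M i n :
  M * i.+1 + i <= n -> M * 'C(n, i) <= 'C(n, n./2).
Proof.
move=> nM; apply: leq_trans (leq_bin_half n i.+1).
rewrite -(leq_pmul2l (ltn0Sn i)) mul_bin_left mulnA [i.+1 * M]mulnC leq_mul2r.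
by apply/orP; right; move: (M * i.+1) nM => z; lia.
Qed.

Lemma La_upper_eventually (d : Order.disp_t) (P : finPOrderType d) M :
  0 < #|P| -> 0 < M -> exists N, forall n, N <= n ->
  La_sharp_star P n * (cstar P * M) <= #|P| * ((M + 2 * cstar P) * 'C(n, n./2)).
Proof.
(* This [K] makes [K - c] equal to [M]; the threshold below lets each of the [K] small binomials
   absorb a factor [K * M]. *)
move=> P0 M0; set c := cstar P; pose K := c + M; have c0 : 0 < c by apply: cstar_gt0.
have K0 : 0 < K by rewrite addn_gt0 c0.
exists (K * M * K + K) => n nN.
have sumC : M * \sum_(i < K) 'C(n, i) <= 'C(n, n./2).
  rewrite -(leq_pmul2l K0) mulnA big_distrr /=.
  have -> : K * 'C(n, n./2) = \sum_(i < K) 'C(n, n./2) by rewrite sum_nat_const card_ord.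
  apply: leq_sum => i _; apply: fixed_bin_negligible; apply: leq_trans nN.
  by apply: leq_add; [rewrite leq_mul2l ltn_ord orbT | apply: ltnW].
have := La_upper P n K0; rewrite -/c (_ : K - c = M); last by rewrite /K addKn.
move/leq_trans; apply; rewrite leq_mul2l; apply/orP; right.
rewrite -mulnA (leq_trans (_ : _ <= K * 'C(n, n./2) + c * 'C(n, n./2))) //.
  by rewrite leq_add2l leq_mul2l sumC orbT.
by rewrite -mulnDl leq_mul2r; apply/orP; right; rewrite /K; lia.
Qed.

Section Asymptotics.
Import numFieldNormedType.Exports.
Local Open Scope ring_scope.
Local Open Scope classical_set_scope.
Variable R : realType.

Lemma cvg_inv_nat : ((n%:R : R)^-1 @[n --> \oo]) --> (0 : R).
Proof. by rewrite -(cvg_shiftS (fun n => (n%:R : R)^-1)); exact: cvg_harmonic. Qed.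

Lemma cvg_half_nat : (((n./2)%:R / n%:R : R) @[n --> \oo]) --> (2^-1 : R).
Proof.
have -> : (2^-1 : R) = 2^-1 - 2^-1 * 0 by rewrite mulr0 subr0.
apply: (@squeeze_cvgr _ _ _ _ (fun n : nat => 2^-1 - 2^-1 * (n%:R : R)^-1) (fun _ => 2^-1)).
- near=> n.
  have n0 : (0 : R) < n%:R by rewrite ltr0n; near: n; exists 1%N.
  have := odd_double_half n => /(congr1 (fun m => m%:R : R)).
  rewrite natrD -muln2 natrM => nE.
  have o0 : (0 : R) <= (odd n)%:R by rewrite ler0n.
  have o1 : (odd n)%:R <= (1 : R) by rewrite lern1; case: (odd n).
  rewrite ler_pdivlMr // ler_pdivrMr // mulrBl -mulrA mulVf ?gt_eqF // mulr1.
  by apply/andP; split; lra.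
- by apply: cvgB; [exact: cvg_cst | apply: cvgM; [exact: cvg_cst | exact: cvg_inv_nat]].
- by rewrite mulr0 subr0; exact: cvg_cst.
Unshelve. all: by end_near. Qed.

Let u K h n : R := 'C(n - K, n./2 - h)%:R / 'C(n, n./2)%:R.

Lemma bin_half_neq0 n : ('C(n, n./2)%:R : R) != 0.
Proof. by rewrite pnatr_eq0 -lt0n bin_gt0; lia. Qed.

Lemma cvg_near_eq (f g : nat -> R) (l : R) :
  (\forall n \near \oo, f n = g n) -> f n @[n --> \oo] --> l -> g n @[n --> \oo] --> l.
Proof. by move=> fg; apply: cvg_trans; apply: near_eq_cvg. Qed.

(** Lowering the bottom index near the middle multiplies the binomial by a factor tending to 1, and
    lowering the top index by a factor tending to 1/2. *)
Lemma cvg_central_bin_shift K h : u K h n @[n --> \oo] --> (2^-1 ^+ K : R).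
Proof.
have cx a : a * (n%:R : R)^-1 @[n --> \oo] --> (0 : R).
  by rewrite -(mulr0 a); apply: cvgM; [exact: cvg_cst | exact: cvg_inv_nat].
elim: K => [|K IHK].
  elim: h => [|h IHh].
    rewrite expr0; apply: (@cvg_near_eq (fun=> 1)); last exact: cvg_cst.
    by apply: nearW => n; rewrite /u !subn0 divff ?bin_half_neq0.
  (* The ratio of ['C(n, n./2 - h.+1)] to ['C(n, n./2 - h)], with numerator and denominator divided
     by [n]. *)
  pose y n := ((n./2)%:R / n%:R - h%:R * (n%:R : R)^-1) /
              (1 - (n./2)%:R / n%:R + h.+1%:R * (n%:R : R)^-1) : R.
  have -> : (2^-1 ^+ 0 : R) = 2^-1 ^+ 0 * ((2^-1 - 0) / (1 - 2^-1 + 0)).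
    have -> : 1 - 2^-1 = 2^-1 :> R by lra.
    by rewrite subr0 addr0 divff ?mulr1 // invr_eq0 pnatr_eq0.
  apply: (@cvg_near_eq (fun n => u 0 h n * y n)); last first.
    apply: cvgM => //.
    apply: cvgM; first by apply: cvgB; [exact: cvg_half_nat | exact: cx].
    apply: cvgV; first by rewrite addr0 gt_eqF //; lra.
    by apply: cvgD; [apply: cvgB; [exact: cvg_cst | exact: cvg_half_nat] | exact: cx].
  exists (h.+1).*2 => // n /= hn.
  have /(congr1 (fun z => z%:R : R)) := mul_bin_left n (n./2 - h.+1).
  have [-> ->] : (n./2 - h.+1).+1 = (n./2 - h)%N /\
                (n - (n./2 - h.+1) = (n - n./2) + h.+1)%N by lia.
  rewrite !natrM natrD !natrB; try lia.
  have X0 : (n%:R : R) != 0 by rewrite pnatr_eq0; lia.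
  have D0 : (n%:R - (n./2)%:R + h.+1%:R : R) != 0.
    by rewrite -natrB ?pnatr_eq0 -?natrD ?pnatr_eq0; lia.
  rewrite /u /y !subn0; have := bin_half_neq0 n.
  move: ('C(n, n./2)%:R) => B B0.
  move: ('C(n, n./2 - h)%:R) ('C(n, n./2 - h.+1)%:R) => C1 C0 e.
  have -> : C0 = (((n./2)%:R - h%:R) * C1) / (n%:R - (n./2)%:R + h.+1%:R).
    by rewrite e mulrAC divff ?mul1r.
  move: D0 X0; move: ((n./2)%:R : R) (n%:R : R) (h%:R : R) (h.+1%:R : R) => Y X H H1 D0 X0.
  by field; rewrite X0 D0 B0.
(* The ratio of ['C(n - K.+1, n./2 - h)] to ['C(n - K, n./2 - h)], scaled likewise. *)
pose y n := (1 - K%:R * (n%:R : R)^-1 - (n./2)%:R / n%:R + h%:R * (n%:R : R)^-1) /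
            (1 - K%:R * (n%:R : R)^-1) : R.
have -> : (2^-1 ^+ K.+1 : R) = 2^-1 ^+ K * ((1 - 0 - 2^-1 + 0) / (1 - 0)).
  by rewrite exprSr; congr (_ * _); field.
apply: (@cvg_near_eq (fun n => u K h n * y n)); last first.
  apply: cvgM => //.
  have c1 : 1 - K%:R * (n%:R : R)^-1 @[n --> \oo] --> (1 - 0 : R).
    by apply: cvgB; [exact: cvg_cst | exact: cx].
  apply: cvgM; last by apply: cvgV => //; rewrite subr0 oner_neq0.
  by apply: cvgD => //; apply: cvgB => //; exact: cvg_half_nat.
exists ((h + K).+1).*2 => // n /= hn.
have /(congr1 (fun z => z%:R : R)) := mul_bin_down (n - K) (n./2 - h).
have [-> ->] : (n - K).-1 = (n - K.+1)%N /\
               (n - K - (n./2 - h) = (n - K - n./2) + h)%N by lia.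
rewrite !natrM natrD !natrB; try lia.
have X0 : (n%:R : R) != 0 by rewrite pnatr_eq0; lia.
have D0 : (n%:R - K%:R : R) != 0 by rewrite -natrB ?pnatr_eq0; lia.
rewrite /u /y; have := bin_half_neq0 n.
move: ('C(n, n./2)%:R) => B B0.
move: ('C(n - K, n./2 - h)%:R) ('C(n - K.+1, n./2 - h)%:R) => C1 C0 e.
have -> : C0 = ((n%:R - K%:R - (n./2)%:R + h%:R) * C1) / (n%:R - K%:R).
  by rewrite -e mulrAC divff ?mul1r.
move: D0 X0; move: ((n./2)%:R : R) (n%:R : R) (h%:R : R) (K%:R : R) => Y X H H1 D0 X0.
by field; rewrite X0 D0 B0.
Qed.

End Asymptotics.

(** * Bounds on the limiting ratio and conclusion *)

Section MainBounds.
Import numFieldNormedType.Exports.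
Local Open Scope ring_scope.
Local Open Scope classical_set_scope.
Variables (R : realType) (d : Order.disp_t) (P : finPOrderType d).
Hypothesis P0 : (0 < #|P|)%N.

Let r n : R := (La_sharp_star P n)%:R / 'C(n, n./2)%:R.

Let bin_half_gt0 n : (0 : R) < 'C(n, n./2)%:R.
Proof. by rewrite lt0r bin_half_neq0 ler0n. Qed.

Let c_gt0 : (0 : R) < (cstar P)%:R.
Proof. by rewrite ltr0n cstar_gt0. Qed.

Let P_gt0 : (0 : R) < #|P|%:R. Proof. by rewrite ltr0n. Qed.

Lemma La_ratio_upper (e : R) : 0 < e ->
  \forall n \near \oo, r n <= #|P|%:R / (cstar P)%:R + e.
Proof.
(* The finite bound overshoots the limit by [2 * #|P| / M], which this choice makes smaller than
   [e]. *)
move=> e0; pose M := (Num.truncn (2 * #|P|%:R / e)).+1.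
have Me : 2 * #|P|%:R / e < M%:R by apply: truncnS_gt.
have [N NP] := La_upper_eventually P0 (isT : (0 < M)%N).
exists N => // n /= /NP; rewrite -(ler_nat R) !natrM natrD natrM => le1.
have M0 : (0 : R) < M%:R by rewrite ltr0n.
rewrite /r ler_pdivrMr // -(ler_pM2r (mulr_gt0 c_gt0 M0)).
apply: le_trans le1 _; move: Me; rewrite ltr_pdivrMr // => /ltW Me.
have cB0 := mulr_gt0 c_gt0 (bin_half_gt0 n); have := ler_wpM2r (ltW cB0) Me.
have c0 := lt0r_neq0 c_gt0.
move: (#|P|%:R : R) (M%:R : R) ((cstar P)%:R : R) ('C(n, n./2)%:R : R) c0 => p m c B c0 le2.
have -> : (p / c + e) * B * (c * m) = p * (m * B) + m * e * (c * B) by field.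
have -> : p * ((m + 2 * c) * B) = p * (m * B) + 2 * p * (c * B) by ring.
by rewrite lerD2l.
Qed.

Lemma La_ratio_lower (e : R) : 0 < e ->
  \forall n \near \oo, #|P|%:R / (cstar P)%:R - e <= r n.
Proof.
move=> e0.
have [k [f [fE cE]]] : closure_size P (cstar P).
  by rewrite /cstar; case: ex_minnP => m /boolp.asboolP.
set c := cstar P in cE *.
have c2 : (c <= 2 ^ k)%N.
  by rewrite -cE -[in leqRHS](card_ord k) -card_set_type max_card.
pose q : R := (2 ^ k - c)%:R / (2 ^ k)%:R.
have k20 : (0 : R) < (2 ^ k)%:R by rewrite ltr0n expn_gt0.
have q1 : `|q| < 1.
  rewrite ger0_norm ?divr_ge0 ?ler0n // ltr_pdivrMr // mul1r ltr_nat.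
  by rewrite ltn_subrL expn_gt0 cstar_gt0.
(* One [e1] pays for the uncovered part of the packing, the other for the convergence of the
   binomial sum. *)
pose e1 := e / #|P|%:R / 2.
have e10 : 0 < e1 by rewrite !divr_gt0.
have [t tP] : exists t, q ^+ t <= e1 * c%:R.
  have /cvgrPdist_le /(_ (e1 * c%:R) (mulr_gt0 e10 c_gt0)) [t _ tP] := cvg_expr q1.
  exists t; have := tP t (leqnn t); rewrite /= sub0r normrN.
  exact: le_trans (ler_norm _).
have [T [I [E [h [pack cT cI]]]]] := dense_packing fE t.
(* This is the packing bound divided by [c * 2 ^ (k * t)], where [q ^+ t] is the uncovered
   proportion. *)
have lI : c%:R^-1 - e1 <= (2^-1 ^+ #|T|) *+ #|I| :> R.
  move: cI; rewrite cE -(ler_nat R) natrD natrM !natrX => cI.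
  have X0 : (0 : R) < 2 ^+ (k * t) by rewrite exprn_gt0.
  have qt : ((2 ^ k - c)%:R : R) ^+ t = q ^+ t * 2 ^+ (k * t).
    rewrite [2 ^+ _]exprM -exprMn /q -[2 ^+ k]natrX divfK ?gt_eqF //.
  rewrite cT -[_ *+ #|I|]mulr_natr exprVn -(ler_pM2r (c_gt0 : 0 < c%:R)) -(ler_pM2r X0).
  have -> : (2 ^+ (k * t))^-1 * #|I|%:R * c%:R * 2 ^+ (k * t) = c%:R * #|I|%:R :> R.
    by rewrite mulrC mulrA mulrA divff ?gt_eqF // mul1r mulrC.
  rewrite mulrBl mulVf ?gt_eqF // mulrBl mul1r lerBlDr (le_trans cI) //.
  by rewrite qt lerD2l ler_pM2r.
have cvgS : \sum_(i : I) ('C(n - #|T|, n./2 - h i)%:R / 'C(n, n./2)%:R) @[n --> \oo]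
    --> ((2^-1 ^+ #|T|) *+ #|I| : R).
  rewrite -sumr_const; apply: cvg_big => [|i _]; [exact: add_continuous | exact: cvg_central_bin_shift].
have /cvgrPdist_le /(_ e1 e10) [N _ NP] := cvgS.
exists (maxn N (maxn #|T| (\max_i h i).*2)) => // n /=.
rewrite !geq_max => /and3P[/NP /= + Tn hn].
have hn2 i : (h i <= n./2)%N.
  by have : (h i <= \max_i h i)%N by [apply: leq_bigmax]; lia.
have := La_lower pack Tn hn2; rewrite -(ler_nat R) natrM natr_sum => low.
move=> /(le_trans (ler_norm _)); rewrite -mulr_suml => near1.
apply: (@le_trans _ _ (#|P|%:R * (c%:R^-1 - 2 * e1))).
  rewrite mulrBr lerD2l lerN2 /e1 le_eqVlt; apply/orP; left; apply/eqP.
  by field; rewrite gt_eqF.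
have near2 : c%:R^-1 - 2 * e1 <= (\sum_i 'C(n - #|T|, n./2 - h i)%:R) / 'C(n, n./2)%:R.
  by move: near1 lI; set X := _ *+ _; lra.
rewrite /r (le_trans (ler_wpM2l (ltW P_gt0) near2)) // mulrA ler_pM2r ?invr_gt0 //.
by rewrite mulrC.
Qed.

End MainBounds.

Lemma La_empty (d : Order.disp_t) (P : finPOrderType d) n :
  #|P| = 0 -> La_sharp_star P n = 0.
Proof.
move=> P0; apply/eqP; rewrite -leqn0; apply/bigmax_leqP => FF /andP[copyFF _].
by apply: leq_trans (card_cover_copies copyFF) _; rewrite P0 muln0.
Qed.

Local Open Scope ring_scope.

Theorem theorem4 (R : realType) (d : Order.disp_t) (P : finPOrderType d) :
  asymp_equiv (fun n : nat => (La_sharp_star P n)%:R : R)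
              (fun n : nat => #|P|%:R / (cstar P)%:R * ('C(n, n./2))%:R).
Proof.
apply/eqaddoP => e e0; have [P0|P0] := posnP #|P|.
  by exists 0 => // n _; rewrite /= !fctE La_empty // P0 !mul0r subrr normr0 mulr0.
have L0 : (0 : R) < #|P|%:R / (cstar P)%:R by rewrite divr_gt0 // ltr0n ?cstar_gt0.
(* An error of [e] times the limit in the ratio is a relative error of [e] against the target
   sequence. *)
have [N1 _ up] := La_ratio_upper P0 (mulr_gt0 e0 L0).
have [N2 _ low] := La_ratio_lower P0 (mulr_gt0 e0 L0).
exists (maxn N1 N2) => // n /=; rewrite geq_max => /andP[/up /= + /low /= +].
have B0 : (0 : R) < 'C(n, n./2)%:R by rewrite lt0r bin_half_neq0 ler0n.
rewrite ler_pdivrMr // ler_pdivlMr // !fctE; move: L0 B0 {up low}.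
move: (_ / (cstar P)%:R) ('C(n, n./2)%:R : R) ((La_sharp_star P n)%:R : R) => L B x L0 B0.
rewrite mulrDl mulrBl -!mulrA => x_le le_x; have LB0 := mulr_gt0 L0 B0.
by change (`|x - L * B : R| <= e * `|L * B : R|); rewrite (gtr0_norm LB0) ler_distl le_x.
Qed.
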